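(* There is a metric space homeomorphic to the Menger curve which is quasisymmetrically co-Hopfian.
   Context: A homeomorphism $f:(X,d_X)\to(Y,d_Y)$ between metric spaces is quasisymmetric (QS) if there is an increasing function $\eta:[0,\infty)\to[0,\infty)$ such that $\frac{d_Y(f(x),f(y))}{d_Y(f(y),f(z))}\le \eta\left(\frac{d_X(x,y)}{d_X(y,z)}\right)$ for all triples of distinct points $x,y,z\in X$. A quasisymmetric embedding is a quasisymmetric homeomorphism onto its image. A metric space $X$ is quasisymmetrically (QS) co-Hopfian if every quasisymmetric embedding of $X$ into itself is onto. The (standard) Menger curve is $\mathscr{M}=\bigcap_{m\ge 0}E_m\subset\mathbb{R}^3$, where $E_0=[0,1]^3$, and $E_{m+1}$ is obtained from $E_m$ (a union of triadic cubes of side length $3^{-m}$) by dividing each of these cubes into $27$ congruent subcubes of side length $3^{-m-1}$ and removing the central subcube and the $6$ subcubes meeting the middle squares of its faces (so that the $20$ subcubes meeting the one-dimensional edges of the cube are kept, and each $E_m$ is closed). *)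

(* Defs.v *)
From HB Require Import structures.
From mathcomp Require Import all_boot all_order all_algebra.
From mathcomp Require Import all_classical all_reals all_analysis.

Set Implicit Arguments.
Unset Strict Implicit.
Unset Printing Implicit Defensive.

Import Order.TTheory GRing.Theory Num.Theory.
Import numFieldNormedType.Exports.

Local Open Scope classical_set_scope.
Local Open Scope ring_scope.

(* A subset of a metric space carries the restricted distance; its topology
   is the library's subspace topology on [set_type A]. *)
Section subset_metric.
Context {R : realType} {X : metricType R} (A : set X).

Definition subset_dist (x y : A) : R := mdist (set_val x) (set_val y).

Lemma subset_dist_ge0 x y : 0 <= subset_dist x y.
Proof. exact: mdist_ge0. Qed.

Lemma subset_dist_positivity x y : subset_dist x y = 0 -> x = y.
Proof. by move=> /mdist_positivity; exact: val_inj. Qed.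

Lemma ball_subset_dist (x : A) (e : R) :
  ball x e = [set y | subset_dist x y < e].
Proof. by rewrite -[ball x e]/(set_val @^-1` ball (set_val x) e) ballEmdist. Qed.

HB.instance Definition _ := @PseudoMetric_isMetric.Build R (A : Type)
  subset_dist subset_dist_ge0 subset_dist_positivity ball_subset_dist.

End subset_metric.

Definition homeomorphism (X Y : topologicalType) (f : X -> Y) : Prop :=
  continuous f /\
  exists g : Y -> X, [/\ cancel f g, cancel g f & continuous g].

Definition homeomorphic (X Y : topologicalType) : Prop :=
  exists f : X -> Y, homeomorphism f.

(* Only the values of [eta] on [0, +oo[ matter. *)
Definition quasisymmetric (R : realType) (X Y : metricType R) (f : X -> Y)
    : Prop :=
  homeomorphism f /\
  exists eta : R -> R,
    [/\ forall t, 0 <= t -> 0 <= eta t,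
        forall s t, 0 <= s -> s < t -> eta s < eta t
      & forall x y z : X, x <> y -> y <> z -> x <> z ->
          mdist (f x) (f y) / mdist (f y) (f z)
            <= eta (mdist x y / mdist y z)].

Definition corestrict (X Y : Type) (f : X -> Y) (x : X) : range f :=
  SigSub (mem_set (imageT f x)).

Definition quasisymmetric_embedding (R : realType) (X Y : metricType R)
    (f : X -> Y) : Prop :=
  quasisymmetric (corestrict f).

Definition qs_co_Hopfian (R : realType) (X : metricType R) : Prop :=
  forall f : X -> X, quasisymmetric_embedding f -> range f = [set: X].

(* A subcube of the 3 x 3 x 3 subdivision of a cube is given by its position
   [d i] in {0, 1, 2} along each axis [i]. *)
Definition central (d : {ffun 'I_3 -> 'I_3}) : bool :=
  [forall i, d i == 1%N :> nat].

(* The subcube meets the middle square of a face orthogonal to axis [i], and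
   is not the central subcube. *)
Definition face_central (d : {ffun 'I_3 -> 'I_3}) : bool :=
  [exists i, (d i != 1%N :> nat) && [forall (j | j != i), d j == 1%N :> nat]].

Definition kept (d : {ffun 'I_3 -> 'I_3}) : bool :=
  ~~ central d && ~~ face_central d.

Section menger.
Variable R : realType.

Definition cube (a : 'rV[R]_3) (s : R) : set 'rV[R]_3 :=
  [set x | forall i, a 0 i <= x 0 i <= a 0 i + s].

(* Lower corners of the triadic cubes of side 3^-m whose union is E_m. *)
Fixpoint menger_corners (m : nat) : set 'rV[R]_3 :=
  if m is m'.+1 then
    [set a + \row_i ((d i)%:R / 3 ^+ m'.+1)
       | a in menger_corners m' & d in [set d | kept d]]
  else [set 0].

Definition menger_stage (m : nat) : set 'rV[R]_3 :=
  \bigcup_(a in menger_corners m) cube a (3 ^- m).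

Definition menger_curve : set 'rV[R]_3 := \bigcap_m menger_stage m.

End menger.
Arguments menger_curve : clear implicits.

(* Main.v *)
Require Import Defs.
From HB Require Import structures.
From mathcomp Require Import all_boot all_order all_algebra.
From mathcomp Require Import all_classical all_reals all_analysis.
From mathcomp Require Import lra zify.
Import numFieldNormedType.Exports.

(** The Menger curve carries a compatible metric that is rigid in a strong
sense: its only quasisymmetric self-embedding is the identity.

Two facts about a quasisymmetric embedding [f] of a bounded connected
metric space are used: [f] is continuous, and it satisfies a lower Hoelder bound
[d (f x) (f y) >= c * d x y ^ b] (a chain of points around [x], each about
twice as far from [x] as the one before, reaches a point at a distance of the
order of the diameter; the number of links is logarithmic in [d x y], and each
link costs a bounded factor, [weak_qs_lower]).  The idea is to make the
identity the only continuous map with such a bound.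

Let [p m] be a sequence that comes back near every point infinitely often.
Start from the ambient metric and add one perturbation for each [m], supported
in the ball of radius [1/(m+1)] about [p m], of height [2 ^- m!], and so steep
that very many points of that ball become pairwise [2 ^- m!]-separated.  For
large [m] the embedding [f] keeps these points at mutual distances greater than
[2 ^- (m * m!)], because [c * (2 ^- m!) ^ b] is larger than that once [m]
exceeds [b] sufficiently.  All later perturbations are at most
[2 ^- (m+1)!], hence invisible at this scale, and the earlier ones
form, together with the ambient metric, a Lipschitz image of a totally bounded
metric; so away from the ball about [p m] there is only room for a bounded
number of images.  That number is known before the [m]-th perturbation is
chosen, and the steepness is chosen to exceed it ([exists_slope]).  Hence some
point of the [m]-th ball is mapped into the [m]-th ball.  Letting [p m]
approach a given [x] along a subsequence yields [f x = x] ([rigid_metric]).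

The argument asks of the space only that it is totally bounded, connected (in
the sense of chains of arbitrarily small steps) and has two points.  For the
Menger curve the chains run along the vertices of the triadic cubes
([edge_closed_all]), which all belong to the curve. *)

Set Implicit Arguments.
Unset Strict Implicit.
Unset Printing Implicit Defensive.

Import Order.TTheory GRing.Theory Num.Theory.
Local Open Scope classical_set_scope.
Local Open Scope ring_scope.

(** * Quasisymmetric embeddings of chain-connected spaces *)

Section metric_spaces.
Context {R : realType}.
Implicit Types E F : metricType R.

Lemma metric_nbhsP E (x : E) (A : set E) :
  nbhs x A <-> exists2 e : R, 0 < e & forall y, mdist x y < e -> A y.
Proof.
rewrite -nbhs_ballE; split=> -[e /= e0 eA]; exists e => //.
  by move=> y xy; apply: eA; rewrite ballEmdist.
by move=> y; rewrite ballEmdist; apply: eA.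
Qed.

Lemma metric_continuousP E F (f : E -> F) :
  continuous f <-> forall x (e : R), 0 < e ->
    exists2 r : R, 0 < r & forall y, mdist x y < r -> mdist (f x) (f y) < e.
Proof.
split=> [cf x e e0|cf x A /metric_nbhsP[e e0 eA]].
  have /cf/metric_nbhsP// : nbhs (f x) [set z | mdist (f x) z < e].
  by apply/metric_nbhsP; exists e.
apply/metric_nbhsP; have [r r0 fr] := cf x e e0.
by exists r => // y /fr/eA.
Qed.

(** Any two points are joined by finite chains of arbitrarily small steps,
expressed through the sets that such chains cannot leave. *)
Definition chain_connected E := forall (e : R) (A : set E),
  0 < e -> A !=set0 -> (forall x y, A x -> mdist x y < e -> A y) ->
  forall x, A x.

(** Totally bounded spaces, in the form that suits a pigeonhole argument. *)
Definition finitely_colorable E := forall e : R, 0 < e ->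
  exists N (color : E -> nat), (forall x, color x < N)%N /\
    forall x y, color x = color y -> mdist x y < e.

(** Chain-connected spaces are uniformly perfect: a chain with steps shorter
than [e] cannot jump over the annulus. *)
Lemma chain_annulus E (e : R) (x a : E) : chain_connected E ->
  0 < e -> e <= mdist x a -> exists z, e <= mdist x z < 2 * e.
Proof.
move=> cE e0 xa; apply: contrapT => noz.
have /(_ a)/= : forall y, mdist x y < e.
  apply: (cE e [set y | mdist x y < e]) => //=.
    by exists x => /=; rewrite mdistxx.
  move=> y z /= xy yz; rewrite ltNge; apply/negP => xz; apply: noz; exists z.
  by rewrite xz (le_lt_trans (metric_triangle x y z))//; lra.
by rewrite ltNge xa.
Qed.

(** All that is retained of quasisymmetry. The ratio 4 comes from comparing
consecutive points of the chains of [weak_qs_lower]; the gauge is evaluated at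
a larger value because its strict monotonicity compares distinct points. *)
Lemma qs_embedding_weak E (f : E -> E) : quasisymmetric_embedding f ->
  [/\ continuous f, injective f &
    exists2 H : R, 1 <= H & forall x y a, x <> y ->
      mdist x a <= 4 * mdist x y ->
      mdist (f x) (f a) <= H * mdist (f x) (f y)].
Proof.
move=> [[cf [g [fK _ _]]] [eta [eta0 etaS etaP]]].
have f_inj : injective f.
  move=> x y fxy; rewrite -(fK x) -(fK y); congr g.
  exact/val_inj.
split=> //.
  apply/metric_continuousP => x e e0.
  by have /metric_continuousP/(_ x e e0) := cf.
exists (1 + eta 5); first by rewrite lerDl eta0.
move=> x y a xy xa.
have xy0 : 0 < mdist x y by rewrite mdist_gt0; apply/eqP.
have fxy0 : 0 < mdist (f x) (f y) by rewrite mdist_gt0; apply/eqP => /f_inj.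
have eta50 : 0 <= eta 5 by rewrite eta0.
have [->|ax] := pselect (a = x).
  by rewrite mdistxx mulr_ge0 ?(ltW fxy0)//; lra.
have [->|ay] := pselect (a = y).
  by rewrite mulrDl mul1r lerDl mulr_ge0// ltW.
have xa4 : mdist a x / mdist x y <= 4 by rewrite ler_pdivrMr// metric_sym.
have : mdist (f a) (f x) / mdist (f x) (f y) <= eta 5.
  apply: (le_trans (etaP a x y ax xy ay)); apply/ltW/etaS; last by lra.
  by rewrite divr_ge0 ?mdist_ge0.
rewrite ler_pdivrMr// metric_sym => /le_trans; apply.
by rewrite ler_pM2r// lerDr.
Qed.

(** One passes from [y] to a point [z] between twice and four times as far from
[x]: this gains a factor 2 in the hypothesis and costs a factor [H]. *)
Lemma weak_qs_lower E (f : E -> E) (H : R) : chain_connected E -> 1 <= H ->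
  (forall x y a, x <> y -> mdist x a <= 4 * mdist x y ->
      mdist (f x) (f a) <= H * mdist (f x) (f y)) ->
  forall k x y a, x <> y -> mdist x a <= 2 ^+ k * mdist x y ->
    mdist (f x) (f a) <= H ^+ k.+1 * mdist (f x) (f y).
Proof.
move=> cE H1 fH; elim=> [|k IH] x y a xy xa.
  by apply: fH => //; have := mdist_ge0 x y; move: xa; rewrite expr0; lra.
have xy0 : 0 < mdist x y by rewrite mdist_gt0; apply/eqP.
have [xa2|xa2] := leP (mdist x a) (2 * mdist x y).
  apply: (le_trans (fH x y a xy _)); first by lra.
  by rewrite ler_wpM2r ?mdist_ge0// ler_eXnr.
have [|z /andP[xz zx]] := chain_annulus cE _ (ltW xa2); first by lra.
have x_z : x <> z by move=> xz'; move: xz; rewrite -xz' mdistxx; lra.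
have xaz : mdist x a <= 2 ^+ k * mdist x z.
  apply: (le_trans xa); rewrite exprSr -mulrA ler_wpM2l// exprn_ge0//.
apply: (le_trans (IH x z a x_z xaz)).
rewrite [H ^+ k.+2]exprSr -mulrA ler_wpM2l//; first by rewrite exprn_ge0//; lra.
by apply: fH => //; lra.
Qed.

(** The scale below which a quasisymmetric embedding can no longer bring points
at distance [height m], once [m] is large. It still exceeds [height m.+1]. *)
Definition threshold (m : nat) : R := 2 ^- (m * m`!).
Definition height (m : nat) : R := 2 ^- m`!.

Lemma exp2_gt (x : R) : exists b, x < 2 ^+ b.
Proof.
exists (Num.truncn x).+1; apply: (lt_le_trans (truncnS_gt x)).
by rewrite -natrX ler_nat ltnW// ltn_expl.
Qed.

Lemma threshold_small (c H : R) : 0 < c -> 1 <= H ->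
  exists m0, forall m, (m0 <= m)%N -> threshold m < c / H ^+ m`!.+1.
Proof.
move=> c0 H1; have [b Hb] := exp2_gt H; have [b' cb'] := exp2_gt c^-1.
exists (b + b + b')%N => m bm; rewrite /threshold.
have H0 : 0 < H by lra.
rewrite ltr_pdivlMr ?exprn_gt0// mulrC ltr_pdivrMr ?exprn_gt0//.
rewrite -ltr_pdivrMl// mulrC.
have : H ^+ m`!.+1 <= 2 ^+ (b * m`!.+1).
  by rewrite exprM lerXn2r ?nnegrE ?exprn_ge0 ?ltW.
move=> HX.
apply: (@le_lt_trans _ _ (2 ^+ (b * m`!.+1) * c^-1)).
  by rewrite ler_pM2r// invr_gt0.
apply: (@lt_le_trans _ _ (2 ^+ (b * m`!.+1) * 2 ^+ b')).
  by rewrite ltr_pM2l// exprn_gt0.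
rewrite -exprD ler_eXn2l ?ltr1n//.
apply: (@leq_trans ((b + b + b') * m`!)); last by rewrite leq_mul2r bm orbT.
by have := fact_gt0 m; nia.
Qed.

(** The lower Hoelder bound, at the scales of the construction. The comparison
point [z] of [x] is one of two fixed points [a], [b]: their images are not both
close to [f x]. *)
Lemma qs_embedding_expands E (f : E -> E) : chain_connected E ->
  (forall x y : E, mdist x y <= 1) -> quasisymmetric_embedding f ->
  exists m0, forall m, (m0 <= m)%N -> forall x y, height m <= mdist x y ->
    threshold m < mdist (f x) (f y).
Proof.
move=> cE E1 /qs_embedding_weak[_ f_inj [H H1 fH]].
have [[a [b ab]]|E_triv] := pselect (exists a b : E, a <> b); last first.
  exists 0%N => m _ x y; have [->|xy] := pselect (x = y).
    by rewrite mdistxx leNgt invr_gt0 exprn_gt0.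
  by case: E_triv; exists x, y.
have fab0 : 0 < mdist (f a) (f b) by rewrite mdist_gt0; apply/eqP => /f_inj.
have [|m0 m0P] := @threshold_small (mdist (f a) (f b) / 2) H _ H1; first by lra.
exists m0 => m /m0P /lt_le_trans + x y hxy; apply.
have H0 : 0 < H by lra.
have x_y : x <> y.
  by move=> xy; move: hxy; rewrite xy mdistxx leNgt invr_gt0 exprn_gt0.
have [z xz] : exists z, mdist (f a) (f b) / 2 <= mdist (f x) (f z).
  have := metric_triangle (f a) (f x) (f b); rewrite (metric_sym (f a) (f x)).
  have [xa _|xa tri] := leP (mdist (f a) (f b) / 2) (mdist (f x) (f a)).
    by exists a.
  by exists b; lra.
rewrite ler_pdivrMr ?exprn_gt0// [leRHS]mulrC; apply: (le_trans xz).
apply: (weak_qs_lower cE H1 fH) => //.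
apply: (le_trans (E1 _ _)); rewrite -ler_pdivrMl ?exprn_gt0//.
by rewrite mulr1.
Qed.

End metric_spaces.

(** * Localized steep perturbations *)

Section spikes.
Context {R : realType} {E : metricType R}.
Implicit Types (c x y z : E) (r h l : R).

Definition depth c r x : R := Num.max 0 (r - mdist c x).

Lemma depth_ge0 c r x : 0 <= depth c r x.
Proof. by rewrite le_max lexx. Qed.

Lemma depth_lip c r x y : depth c r x <= mdist x y + depth c r y.
Proof.
have := metric_triangle c x y; have := metric_triangle c y x.
rewrite (metric_sym y x) /depth ge_max => tx ty.
have := mdist_ge0 x y; have := depth_ge0 c r y; rewrite /depth => d0 xy0.
have : r - mdist c y <= Num.max 0 (r - mdist c y) by rewrite le_max lexx orbT.
by move=> rd; apply/andP; split; lra.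
Qed.

Lemma depth_out c r x : r <= mdist c x -> depth c r x = 0.
Proof. by move=> rx; apply/max_idPl; lra. Qed.

(** The metric [l * mdist] on the ball of radius [r] about [c], with the
complement of the ball collapsed to one point and the distances truncated at
[h]: either one moves inside the ball, or one passes through its outside. *)
Definition spike c r h l x y : R :=
  Num.min h (l * Num.min (mdist x y) (depth c r x + depth c r y)).

Lemma spike_sym c r h l x y : spike c r h l x y = spike c r h l y x.
Proof. by rewrite /spike metric_sym addrC. Qed.

Lemma spike_le_height c r h l x y : spike c r h l x y <= h.
Proof. by rewrite ge_min lexx. Qed.

Lemma spike_lip c r h l x y : 0 <= l -> spike c r h l x y <= l * mdist x y.
Proof. by move=> l0; rewrite ge_min ler_wpM2l ?orbT// ge_min lexx. Qed.

Lemma spikexx c r h l x : 0 <= h -> spike c r h l x x = 0.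
Proof.
move=> h0; rewrite /spike mdistxx [Num.min 0 _]min_l ?mulr0 ?min_r//.
by rewrite addr_ge0 ?depth_ge0.
Qed.

Lemma spike_out c r h l x y : 0 <= h -> r <= mdist c x -> r <= mdist c y ->
  spike c r h l x y = 0.
Proof.
move=> h0 rx ry; rewrite /spike !depth_out// addr0.
by rewrite [Num.min _ 0]min_r ?mdist_ge0// mulr0 min_r.
Qed.

Lemma spike_triangle c r h l x y z : 0 <= h -> 0 <= l ->
  spike c r h l x z <= spike c r h l x y + spike c r h l y z.
Proof.
move=> h0 l0; rewrite /spike.
set q := fun x y => Num.min (mdist x y) (depth c r x + depth c r y).
have q_ge0 u v : 0 <= q u v.
  by rewrite /q le_min mdist_ge0 addr_ge0 ?depth_ge0.
have q_tri : q x z <= q x y + q y z.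
  have := metric_triangle x y z; have := depth_lip c r x y.
  have := depth_lip c r z y; rewrite (metric_sym z y).
  have := depth_ge0 c r x; have := depth_ge0 c r y; have := depth_ge0 c r z.
  rewrite /q; move: (mdist x y) (mdist y z) (mdist x z) => dxy dyz dxz.
  move: (depth c r x) (depth c r y) (depth c r z) => tx ty tz *.
  rewrite ge_min; apply/orP.
  have [?|?] := leP dxy (tx + ty); have [?|?] := leP dyz (ty + tz).
  - by left; lra.
  - by right; lra.
  - by right; lra.
  - by right; lra.
have : l * q x z <= l * q x y + l * q y z by rewrite -mulrDr ler_wpM2l.
have : 0 <= l * q x y by rewrite mulr_ge0.
have : 0 <= l * q y z by rewrite mulr_ge0.
rewrite -![Num.min _ (_ + _)]/(q _ _).
move: (l * q x y) (l * q y z) (l * q x z) => a b e a0 b0 eab.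
rewrite ge_min; apply/orP.
have [?|?] := leP h a; have [?|?] := leP h b.
- by left; lra.
- by left; lra.
- by left; lra.
- by right; lra.
Qed.

End spikes.

(** * The perturbed metric *)

Section spiky_metric.
Context {R : realType} {E : metricType R}.
Variables (p : nat -> E) (g : nat -> R -> R).
Hypothesis g_ge0 : forall m t, 0 <= g m t.

Definition reach (m : nat) : R := m.+1%:R^-1.

(** The rule [g] chooses the slope of a perturbation from its index and from
the Lipschitz constant of everything constructed before. *)
Fixpoint lip_const (m : nat) : R :=
  if m is m'.+1 then lip_const m' + g m' (lip_const m') else 1.

Definition slope m : R := g m (lip_const m).

Definition layer (x y : E) (n : nat) : R :=
  if n is m.+1
  then spike (p m) (reach m) (height m) (slope m) x y else mdist x y.

Definition spiky (x y : E) : R := sup (range (layer x y)).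

Lemma slope_ge0 m : 0 <= slope m. Proof. exact: g_ge0. Qed.

Lemma lip_const_mono m n : (m <= n)%N -> lip_const m <= lip_const n.
Proof.
move=> mn; rewrite -(subnK mn); elim: (n - m)%N => //= k IH.
by apply: (le_trans IH); rewrite lerDl g_ge0.
Qed.

Lemma lip_const_ge1 m : 1 <= lip_const m.
Proof. exact: (lip_const_mono (leq0n m)). Qed.

Lemma slope_le m n : (m < n)%N -> slope m <= lip_const n.
Proof.
move=> /lip_const_mono; apply: le_trans => /=.
rewrite [leLHS]/slope lerDr; apply: (le_trans ler01).
exact: lip_const_ge1.
Qed.

Lemma height_gt0 m : 0 < height m :> R.
Proof. by rewrite invr_gt0 exprn_gt0. Qed.

Lemma height_mono m n : (m <= n)%N -> height n <= height m :> R.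
Proof.
move=> mn; rewrite lef_pV2 ?posrE ?exprn_gt0// ler_eXn2l ?ltr1n//.
by rewrite leq_fact.
Qed.

Lemma height_le1 m : height m <= 1 :> R.
Proof. by rewrite invf_le1 ?exprn_gt0// exprn_ege1// ler1n. Qed.

Lemma layer_le x y n : layer x y n <= Num.max 1 (mdist x y).
Proof.
case: n => [|m] /=; rewrite le_max ?lexx ?orbT//.
by rewrite (le_trans (spike_le_height _ _ _ _ _ _)) ?height_le1.
Qed.

Lemma spiky_ge x y n : layer x y n <= spiky x y.
Proof.
apply: ub_le_sup; last by exists n.
by exists (Num.max 1 (mdist x y)) => _ [k _ <-]; exact: layer_le.
Qed.

Lemma spiky_le x y e : (forall n, layer x y n <= e) -> spiky x y <= e.
Proof.
move=> xye; apply: ge_sup; first by exists (layer x y 0); exists 0%N.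
by move=> _ [n _ <-].
Qed.

Lemma mdist_le_spiky x y : mdist x y <= spiky x y.
Proof. exact: (spiky_ge x y 0). Qed.

Lemma spikyxx x : spiky x x = 0.
Proof.
apply/eqP; rewrite eq_le; apply/andP; split; last first.
  by rewrite -(mdistxx x) mdist_le_spiky.
apply: spiky_le => -[|m] /=; first by rewrite mdistxx.
by rewrite spikexx// ltW ?height_gt0.
Qed.

Lemma spiky_positivity x y : spiky x y = 0 -> x = y.
Proof.
move=> xy; apply: mdist_positivity; apply/eqP; rewrite eq_le mdist_ge0 andbT.
by rewrite -xy mdist_le_spiky.
Qed.

Lemma spiky_sym x y : spiky x y = spiky y x.
Proof.
rewrite /spiky (_ : layer x y = layer y x)//.
by apply/funext => -[|m]; [exact: metric_sym | exact: spike_sym].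
Qed.

Lemma spiky_triangle y x z : spiky x z <= spiky x y + spiky y z.
Proof.
apply: spiky_le => n; apply: (@le_trans _ _ (layer x y n + layer y z n)).
  case: n => [|m] /=; first exact: metric_triangle.
  by rewrite spike_triangle ?slope_ge0// ltW ?height_gt0.
by rewrite lerD ?spiky_ge.
Qed.

(** The perturbations before the [m]-th are Lipschitz and the others are at
most [height m]; hence the new metric is uniformly equivalent to the old. *)
Lemma spiky_lip m x y :
  spiky x y <= Num.max (lip_const m * mdist x y) (height m).
Proof.
apply: spiky_le => -[|n] /=; rewrite le_max.
  by rewrite ler_peMl ?mdist_ge0 ?lip_const_ge1.
have [nm|mn] := ltnP n m.
  rewrite (le_trans (spike_lip _ _ _ _ _ (slope_ge0 n)))//.
  by rewrite ler_wpM2r ?mdist_ge0 ?slope_le.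
apply/orP; right; apply: (le_trans (spike_le_height _ _ _ _ _ _)).
exact: height_mono.
Qed.

(** If [x] and [y] avoid the [m]-th ball, then the [m]-th perturbation does not
see them, and the later ones stay below the threshold. *)
Lemma spiky_lip_out m x y :
  reach m <= mdist (p m) x -> reach m <= mdist (p m) y ->
  spiky x y <= Num.max (lip_const m * mdist x y) (threshold m).
Proof.
move=> xm ym; apply: spiky_le => -[|n] /=; rewrite le_max.
  by rewrite ler_peMl ?mdist_ge0 ?lip_const_ge1.
have [nm|mn|->] := ltngtP n m.
- rewrite (le_trans (spike_lip _ _ _ _ _ (slope_ge0 n)))//.
  by rewrite ler_wpM2r ?mdist_ge0 ?slope_le.
- apply/orP; right; apply: (le_trans (spike_le_height _ _ _ _ _ _)).
  apply: (le_trans (height_mono mn)).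
  rewrite lef_pV2 ?posrE ?exprn_gt0// ler_eXn2l ?ltr1n//.
  by rewrite factS leq_mul2r leqnSn orbT.
- rewrite spike_out ?(ltW (height_gt0 _))//.
  by rewrite invr_ge0 exprn_ge0 ?orbT.
Qed.

Lemma spiky_ge_height m x y :
  height m <= spike (p m) (reach m) (height m) (slope m) x y ->
  height m <= spiky x y.
Proof. by move=> /le_trans; apply; exact: (spiky_ge x y m.+1). Qed.

Lemma height_to0 (e : R) : 0 < e -> exists m, height m < e.
Proof.
move=> e0; have [b eb] := exp2_gt e^-1; exists b.
rewrite /height invf_plt ?posrE ?exprn_gt0//; apply: (lt_le_trans eb).
by rewrite ler_eXn2l ?ltr1n// fact_geq.
Qed.

Lemma spiky_unif (e : R) : 0 < e -> exists2 r : R, 0 < r &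
  forall x y, mdist x y < r -> spiky x y < e.
Proof.
move=> e0; have [m me] := height_to0 e0.
have L0 : 0 < lip_const m by have := lip_const_ge1 m; lra.
exists (e / lip_const m); first by rewrite divr_gt0.
move=> x y; rewrite ltr_pdivlMr// mulrC => xy.
by rewrite (le_lt_trans (spiky_lip m x y))// gt_max xy.
Qed.

End spiky_metric.

(** * Rigidity *)

Section metrize.
Context {R : realType}.

Record is_distance (T : Type) (d : T -> T -> R) : Prop := IsDistance {
  distance_refl : forall x, d x x = 0 ;
  distance_positivity : forall x y, d x y = 0 -> x = y ;
  distance_sym : forall x y, d x y = d y x ;
  distance_triangle : forall y x z, d x z <= d x y + d y z }.

(** The proof [dP] occurs in the type only to select the metric instance. *)
Definition metrized (T : choiceType) (d : T -> T -> R) (dP : is_distance d)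
  : Type := T.

HB.instance Definition _ T d dP := Choice.copy (@metrized T d dP) T.
HB.instance Definition _ T d dP := @isMetric.Build R (@metrized T d dP) d
  (distance_refl dP) (distance_positivity dP) (distance_sym dP)
  (distance_triangle dP).

End metrize.

Section rigidity.
Context {R : realType} {E : metricType R}.
Hypothesis E_chain : chain_connected E.
Hypothesis E_pair : exists a b : E, a <> b.

Lemma chain_nearby (c : E) (r : R) : 0 < r ->
  exists2 y, 0 < mdist c y & mdist c y < r.
Proof.
move=> r0; apply: contrapT => noy.
have eqc y : y = c.
  apply: (E_chain (e := r) (A := [set y | y = c])) => //; first by exists c.
  move=> x z /= -> cz; apply: contrapT => zc; apply: noy; exists z => //.
  by rewrite mdist_gt0; apply/eqP => /esym.
by have [a [b]] := E_pair; rewrite (eqc a) (eqc b).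
Qed.

(** Each point is less than half as far from [c] as the previous one, so two of
the points differ by at least half the distance of the nearest one to [c]. *)
Lemma separated_points (c : E) (r : R) N : 0 < r -> exists (q : nat -> E) s,
  [/\ 0 < s, forall i, mdist c (q i) < r &
    forall i j, (i < j <= N)%N -> s <= mdist (q i) (q j)].
Proof.
move=> r0.
have /choice[w wP] (t : R) : exists y : E,
    0 < t -> 0 < mdist c y /\ mdist c y < t.
  have [t0|t0] := ltP 0 t; last by exists c.
  by have [y y0 yt] := chain_nearby c t0; exists y.
pose q := fix q n := if n is n'.+1 then w (mdist c (q n') / 2) else w r.
have q_gt0 n : 0 < mdist c (q n).
  elim: n => [|n IH] /=; first by case: (wP r r0).
  by case: (wP (mdist c (q n) / 2)) => //; lra.
have qS n : mdist c (q n.+1) < mdist c (q n) / 2.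
  by case: (wP (mdist c (q n) / 2)) => //; have := q_gt0 n; lra.
have q_decr i j : (i <= j)%N -> mdist c (q j) <= mdist c (q i).
  move=> ij; rewrite -(subnK ij); elim: (j - i)%N => //= k IH.
  by have := qS (k + i)%N; have := q_gt0 (k + i)%N; rewrite /= in IH *; lra.
exists q, (mdist c (q N) / 2); split; first by have := q_gt0 N; lra.
  by move=> i; rewrite (le_lt_trans (q_decr 0%N i _))//=; case: (wP r r0).
move=> i j /andP[ij jN].
have := q_decr _ _ ij; have := qS i; have := q_decr _ _ jN.
have := q_decr _ _ (ltnW ij).
have := metric_triangle c (q j) (q i); rewrite (metric_sym (q j)).
by have := q_gt0 i; rewrite /=; lra.
Qed.

Hypothesis E_color : finitely_colorable E.
Variable p : nat -> E.

(** With slope [l], the [m]-th ball contains more points at mutual distance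
[height m] than there is room for outside of it at scale [threshold m], in a
metric that is [L]-Lipschitz with respect to the original one. *)
Definition overflows (m : nat) (L l : R) := forall f : E -> E,
  (forall x y, reach m <= mdist (p m) (f x) -> reach m <= mdist (p m) (f y) ->
    height m <= spike (p m) (reach m) (height m) l x y ->
    threshold m < L * mdist (f x) (f y)) ->
  exists2 x, mdist (p m) x < reach m & mdist (p m) (f x) < reach m.

(** The complement of the ball has room for [N] points, where [N] depends on
[L] but not on the slope; the ball contains [N + 1] points, and a sufficiently
large slope spreads them to the full height. *)
Lemma exists_slope m L : exists l : R, 0 <= l /\ (0 < L -> overflows m L l).
Proof.
have [L0|L0] := ltP 0 L; last by exists 0.
have rad0 : 0 < reach m :> R by rewrite invr_gt0.
have h0 : 0 < height m :> R := height_gt0 m.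
have [|N [color [colorN colorP]]] := E_color (e := threshold m / L).
  by rewrite divr_gt0// invr_gt0 exprn_gt0.
have [|q [s [s0 qc qs]]] := separated_points (p m) (r := reach m / 2) N.
  by lra.
pose s' := Num.min s (reach m).
have s'0 : 0 < s' by rewrite lt_min s0.
exists (height m / s'); split; first by rewrite divr_ge0 ?ltW.
move=> _ f fP; apply: contrapT => no_x.
have f_out i : reach m <= mdist (p m) (f (q i)).
  rewrite leNgt; apply/negP => fin; apply: no_x; exists (q i) => //.
  by have := qc i; lra.
have q_spike i j : (i < j <= N)%N ->
    height m <= spike (p m) (reach m) (height m) (height m / s') (q i) (q j).
  move=> /qs qij; rewrite /spike le_min lexx /= mulrAC ler_pdivlMr//.
  rewrite ler_wpM2l ?(ltW h0)// le_min; apply/andP; split.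
    by rewrite ge_min qij.
  rewrite ge_min; apply/orP; right.
  have dq k : reach m / 2 <= depth (p m) (reach m) (q k).
    by rewrite le_max; apply/orP; right; have := qc k; lra.
  by have := dq i; have := dq j; lra.
have col_neq i j : (i < j <= N)%N -> color (f (q i)) <> color (f (q j)).
  move=> ij /colorP; rewrite ltr_pdivlMr// mulrC ltNge => /negP; apply.
  by apply/ltW/fP => //; exact: q_spike.
pose k (i : 'I_N.+1) : 'I_N := Ordinal (colorN (f (q i))).
suff /leq_card : injective k by rewrite !card_ord ltnn.
move=> i j /(congr1 val) /= kij; apply: val_inj.
have [ij|ij|//] := ltngtP (val i) (val j).
  by case: (col_neq i j) => //; rewrite ij -ltnS ltn_ord.
by case: (col_neq j i) => //; rewrite ij -ltnS ltn_ord.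
Qed.

Theorem rigid_metric : (forall x y : E, mdist x y <= 1) ->
  (forall x (e : R) m0, 0 < e -> exists2 m, (m0 <= m)%N & mdist x (p m) < e) ->
  exists X : metricType R, homeomorphic X E /\
    forall f : X -> X, quasisymmetric_embedding f -> f =1 id.
Proof.
move=> E1 p_rec.
have /choice[g gP] (mL : nat * R) : exists l : R,
    0 <= l /\ (0 < mL.2 -> overflows mL.1 mL.2 l).
  by case: mL => m L; exact: exists_slope.
pose G m L := g (m, L).
have G0 m L : 0 <= G m L by case: (gP (m, L)).
pose d := spiky p G.
have dP : is_distance d.
  split; [exact: spikyxx|exact: spiky_positivity|exact: spiky_sym|].
  exact: spiky_triangle.
pose X : metricType R := metrized dP.
have d_unif := spiky_unif p G0.
exists X; split.
  exists (id : X -> E); split.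
    apply/metric_continuousP => x e e0; exists e => // y.
    by apply: le_lt_trans; exact: mdist_le_spiky.
  exists (id : E -> X); split => //.
  apply/metric_continuousP => x e e0; have [r r0 rP] := d_unif e e0.
  by exists r => // y; exact: rP.
have X_chain : chain_connected X.
  move=> e A e0 A0 AP; have [r r0 rP] := d_unif e e0.
  by apply: (E_chain r0 A0) => x y Ax xy; apply: AP Ax _; exact: rP.
have X1 (x y : X) : mdist x y <= 1.
  apply: spiky_le => n; apply: (le_trans (layer_le _ _ _ _ _)).
  by rewrite ge_max lexx E1.
move=> f fqs x; apply: contrapT => fx.
have [m0 m0P] := qs_embedding_expands X_chain X1 fqs.
have [/metric_continuousP cf _ _] := qs_embedding_weak fqs.
pose D := @mdist R E x (f x).
have D0 : 0 < D by rewrite mdist_gt0; apply/eqP => xfx; exact: fx.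
have [|r r0 rP] := cf x (D / 4); first by lra.
have [r' r'0 r'P] := d_unif r r0.
pose t := Num.min (D / 4) (r' / 2).
have t0 : 0 < t by rewrite lt_min; apply/andP; split; lra.
have tD : t <= D / 4 by rewrite ge_min lexx.
have tr : t <= r' / 2 by rewrite ge_min lexx orbT.
have [m1 m1P] : exists m1, forall m, (m1 <= m)%N -> reach m < t.
  exists (Num.truncn t^-1) => m tm; rewrite invf_plt ?posrE//.
  by apply: (lt_le_trans (truncnS_gt _)); rewrite ler_nat.
have [m mm xm] := p_rec x t (maxn m0 m1) t0.
have {mm} [mm0 mm1] : (m0 <= m)%N /\ (m1 <= m)%N.
  by apply/andP; rewrite -geq_max.
have rt := m1P m mm1.
have ov : overflows m (lip_const G m) (slope G m).
  apply: (gP (m, lip_const G m)).2 => /=.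
  by rewrite (lt_le_trans ltr01)// lip_const_ge1.
have [|y ym fym] := ov (f : E -> E).
  move=> u v ufo vfo uv.
  have /= := m0P m mm0 u v (spiky_ge_height uv).
  move=> /lt_le_trans/(_ (spiky_lip_out G0 ufo vfo)).
  by rewrite lt_max ltxx orbF.
have xy := @metric_triangle R E x (p m) y.
have xfy := @metric_triangle R E x (p m) (f y).
have xyr : @mdist R E x y < r' by lra.
(* [f] moves [y], which lies near [x], to another point near [x], and by
   continuity [f y] is near [f x]. *)
have fxy : @mdist R E (f x) (f y) < D / 4.
  apply: le_lt_trans (rP y (r'P _ _ xyr)); exact: mdist_le_spiky.
have := @metric_triangle R E x (f y) (f x).
rewrite (@metric_sym R E (f y) (f x)) -/D; lra.
Qed.

End rigidity.

(** * Recurrent sequences *)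

Section recurrent.
Context {R : realType} {E : metricType R}.

Lemma injective_unbounded (u : nat -> nat) (k0 m0 : nat) : injective u ->
  exists2 k, (k0 <= k)%N & (m0 <= u k)%N.
Proof.
move=> u_inj; apply: contrapT => nok.
have um (i : 'I_m0.+1) : (u (k0 + i) < m0)%N.
  rewrite ltnNge; apply/negP => m0u; apply: nok.
  by exists (k0 + i)%N => //; rewrite leq_addr.
suff /leq_card : injective (fun i => Ordinal (um i)) by rewrite !card_ord ltnn.
by move=> i j /(congr1 val) /= /u_inj/addnI; exact: val_inj.
Qed.

(** Choose a point in every color class at every scale [1/(k+1)]. For a given
[x] and each [k] the chosen point of the class of [x] is close to [x], and its
index in the enumeration is unbounded in [k]. *)
Lemma recurrent_sequence (x0 : E) : finitely_colorable E ->
  exists p : nat -> E, forall x (e : R) m0, 0 < e ->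
    exists2 m, (m0 <= m)%N & mdist x (p m) < e.
Proof.
move=> colE.
have /choice[c cP] (k : nat) : exists c : E -> nat,
    forall x y, c x = c y -> mdist x y < k.+1%:R^-1.
  by have [|N [c [_ cP]]] := colE k.+1%:R^-1; [rewrite invr_gt0|exists c].
have /choice[pt ptP] (ki : nat * nat) : exists y : E,
    forall z, c ki.1 z = ki.2 -> c ki.1 y = ki.2.
  have [[z zk]|noz] := pselect (exists z, c ki.1 z = ki.2); first by exists z.
  by exists x0 => z zk; case: noz; exists z.
exists (fun m => if unpickle m is Some ki then pt ki else x0) => x e m0 e0.
have [|k k0 km] := @injective_unbounded (fun k => pickle (k, c k x))
    (Num.truncn e^-1) m0.
  by move=> k l /(pcan_inj pickleK) [].
exists (pickle (k, c k x)) => //; rewrite pickleK.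
apply: (@lt_trans _ _ k.+1%:R^-1); first by apply: cP; rewrite (ptP (k, _) x).
rewrite invf_plt ?posrE//; apply: (lt_le_trans (truncnS_gt _)).
by rewrite ler_nat.
Qed.

End recurrent.

(** * The Menger curve *)

Section matrix_metric.
Context {R : realType} (m n : nat).
Implicit Types x y : 'M[R]_(m.+1, n.+1).

Let dist x y : R := `|x - y|.

Let dist_ge0 x y : 0 <= dist x y. Proof. exact: normr_ge0. Qed.

Let dist_positivity x y : dist x y = 0 -> x = y.
Proof. by move=> /eqP; rewrite normr_eq0 subr_eq0 => /eqP. Qed.

Let ball_dist x (e : R) : ball x e = [set y | dist x y < e].
Proof. by rewrite -ball_normE. Qed.

HB.instance Definition _ := @PseudoMetric_isMetric.Build R 'M[R]_(m.+1, n.+1)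
  dist dist_ge0 dist_positivity ball_dist.

Lemma mx_norm_leP (x : 'M[R]_(m.+1, n.+1)) (e : R) : 0 <= e ->
  (forall i j, `|x i j| <= e) -> `|x| <= e.
Proof.
move=> e0 xe; rewrite [`|x|]mx_normrE; apply: bigmax_le => // ij _; exact: xe.
Qed.

End matrix_metric.

Section menger.
Variable R : realType.
Local Notation point := 'rV[R]_3.
Local Notation digits := {ffun 'I_3 -> 'I_3}.
Implicit Types (a x y : point) (d : digits) (v w : 'I_3 -> bool).

(** The removed subcubes are those with two central coordinates or more. *)
Lemma keptP d :
  kept d <-> exists i j, [/\ i != j, d i != 1%N :> nat & d j != 1%N :> nat].
Proof.
rewrite /kept /central /face_central; split.
  move=> /andP[/forallPn[i di] /existsPn/(_ i)].
  by rewrite di /= => /forall_inPn[j ji dj]; exists j, i.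
move=> [i [j [ij di dj]]]; apply/andP; split.
  by apply/forallPn; exists i.
apply/existsPn => k; rewrite negb_and; apply/orP; right.
apply/forall_inPn; have [ki|ki] := eqVneq i k; last by exists i.
by exists j => //; rewrite unfold_in -ki eq_sym.
Qed.

Definition vertex a (s : R) v : point := a + \row_i (if v i then s else 0).

Definition subcorner (m : nat) a d : point :=
  a + \row_i ((d i)%:R / 3 ^+ m.+1).

Lemma subcorner_corners m a d : menger_corners m a -> kept d ->
  menger_corners m.+1 (subcorner m a d).
Proof. by move=> am kd; exists a => //; exists d. Qed.

Lemma inv_exp3S m : (3 : R) ^- m = 3 * 3 ^- m.+1.
Proof. by rewrite exprS invfM mulrA mulfV ?mul1r// pnatr_eq0. Qed.

Definition corner_digits v : digits :=
  [ffun i => if v i then ord_max else ord0].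

Lemma kept_corner_digits v : kept (corner_digits v).
Proof.
apply/keptP; exists ord0, ord_max; split => //.
all: by rewrite ffunE; case: ifP.
Qed.

Lemma vertex_refine m a v : vertex a (3 ^- m) v =
  vertex (subcorner m a (corner_digits v)) (3 ^- m.+1) v.
Proof.
apply/rowP => i; rewrite !mxE -addrA ffunE inv_exp3S; congr (_ + _).
by case: ifP => _ /=; lra.
Qed.

Lemma corners_sub m k a v : menger_corners m a ->
  exists2 a', menger_corners (m + k) a' &
    vertex a (3 ^- m) v = vertex a' (3 ^- (m + k)) v.
Proof.
move=> am; elim: k => [|k [a' a'm ->]]; first by rewrite addn0; exists a.
rewrite addnS vertex_refine; eexists; last reflexivity.
by apply: subcorner_corners => //; exact: kept_corner_digits.
Qed.

Lemma menger_stage_decr m : menger_stage (R:=R) m.+1 `<=` menger_stage (R:=R) m.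
Proof.
move=> x [_ [a am [d _ <-]] xa]; exists a => // i.
have := xa i; rewrite !mxE => /andP[lo hi].
have s0 : 0 < (3 : R) ^- m.+1 by rewrite invr_gt0 exprn_gt0.
have d0 : 0 <= (d i)%:R * (3 : R) ^- m.+1 by rewrite mulr_ge0// ltW.
have d2 : (d i)%:R * (3 : R) ^- m.+1 <= 2 * 3 ^- m.+1.
  by rewrite ler_wpM2r ?(ltW s0)// ler_nat -ltnS.
by rewrite inv_exp3S; apply/andP; split; lra.
Qed.

Lemma menger_stage_mono m n : (m <= n)%N ->
  menger_stage (R:=R) n `<=` menger_stage (R:=R) m.
Proof.
move=> mn; rewrite -(subnK mn); elim: (n - m)%N => //= k IH.
by apply: subset_trans IH; exact: menger_stage_decr.
Qed.

(** The vertex of a cube is again a vertex of one of its kept subcubes, hence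
it is never removed. *)
Lemma vertex_menger m a v : menger_corners m a ->
  menger_curve R (vertex a (3 ^- m) v).
Proof.
move=> am n _; apply: (menger_stage_mono (leq_addl m n)).
have [a' a'm ->] := corners_sub n v am.
exists a' => // i; rewrite !mxE; case: ifP => _.
  by rewrite lerDl lexx andbT invr_ge0 exprn_ge0.
by rewrite addr0 lexx lerDl invr_ge0 exprn_ge0.
Qed.

(** The trace on the vertices of a set that chains with steps of length
[3 ^- m] cannot leave. *)
Definition edge_closed (m : nat) (A : set point) := forall a v w,
  menger_corners m a -> A (vertex a (3 ^- m) v) -> A (vertex a (3 ^- m) w).

Definition set_digit d (k : 'I_3) (c : 'I_3) : digits :=
  [ffun i => if i == k then c else d i].

Lemma kept_set_digit d i j k c : i != j -> i != k -> j != k ->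
  d i != 1%N :> nat -> d j != 1%N :> nat -> kept (set_digit d k c).
Proof.
move=> ij ik jk di dj; apply/keptP; exists i, j; split => //; rewrite ffunE.
  by rewrite (negPf ik).
by rewrite (negPf jk).
Qed.

Lemma shared_vertex m a d k (c c' : 'I_3) : c' = c.+1 :> nat ->
  vertex (subcorner m a (set_digit d k c)) (3 ^- m.+1) (fun i => i == k) =
  vertex (subcorner m a (set_digit d k c')) (3 ^- m.+1) (fun=> false).
Proof.
move=> cc'; apply/rowP => i; rewrite !mxE !ffunE -!addrA; congr (_ + _).
case: eqP => _; last by [].
by rewrite cc' -[c.+1%:R]natr1 mulrDl mul1r addr0.
Qed.

Lemma third_index (i j : 'I_3) : i != j ->
  exists k, [/\ i != k, j != k & forall l, [|| l == i, l == j | l == k]].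
Proof.
move: i j => [[|[|[|//]]] ?] [[|[|[|//]]] ?] //= _.
all: [> exists (inord 2) | exists (inord 1) | exists (inord 2)
  | exists (inord 0) | exists (inord 1) | exists (inord 0)].
all: rewrite -!val_eqE /= !inordK//; split=> // -[[|[|[|//]]] ?].
all: by rewrite -!val_eqE /= ?inordK.
Qed.

(** The 20 kept subcubes form a connected graph: from any of them one reaches
the subcube with digits 0 through neighbors that share a vertex. Two digits
different from 1 keep a cube, whatever the third one is: so one first lowers
the third digit, and then each of the two others, which may need to pass
through 1 while the two digits at rest keep the cube. *)
Lemma edge_closed_subcubes m a (A : set point) d d' v v' :
  menger_corners m a -> edge_closed m.+1 A -> kept d -> kept d' ->
  A (vertex (subcorner m a d) (3 ^- m.+1) v) ->
  A (vertex (subcorner m a d') (3 ^- m.+1) v').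
Proof.
move=> am Acl.
pose B d := A (vertex (subcorner m a d) (3 ^- m.+1) (fun=> false)).
have BP e w : kept e -> B e <-> A (vertex (subcorner m a e) (3 ^- m.+1) w).
  by move=> ke; split; apply: Acl; exact: subcorner_corners.
have step e k (c c' : 'I_3) : c' = c.+1 :> nat ->
    kept (set_digit e k c) -> (B (set_digit e k c) <-> B (set_digit e k c')).
  move=> cc' kc.
  by rewrite (BP _ (fun i => i == k) kc) (shared_vertex _ _ _ _ cc').
have lower (e : digits) (i j k : 'I_3) : i != j -> i != k -> j != k ->
    e i != 1%N :> nat -> e j != 1%N :> nat -> B e <-> B (set_digit e k ord0).
  move=> ij ik jk ei ej.
  have ke c : kept (set_digit e k c) by exact: kept_set_digit ei ej.
  have s1 := step e k ord0 (inord 1) (inordK _) (ke _).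
  have s2 := step e k (inord 1) ord_max _ (ke _).
  rewrite s1//.
  have {1}-> : e = set_digit e k (e k).
    by apply/ffunP => l; rewrite ffunE; case: eqP => // ->.
  have [e0|e1|e2] : [\/ e k = ord0, e k = inord 1 | e k = ord_max].
    case: (e k) => -[|[|[|//]]] ?; [constructor 1|constructor 2|constructor 3];
      apply: val_inj; rewrite //= inordK//.
  - by rewrite e0 s1.
  - by rewrite e1.
  - by rewrite e2 -s2// inordK.
pose z : digits := [ffun=> ord0].
have to0 (e : digits) : kept e -> B e <-> B z.
  move=> /keptP[i [j [ij ei ej]]]; have [k [ik jk ijk]] := third_index ij.
  have ji : j != i by rewrite eq_sym.
  have ki : k != i by rewrite eq_sym.
  have kj : k != j by rewrite eq_sym.
  rewrite (lower e i j k)// (lower _ j k i)//; last 2 first.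
  - by rewrite ffunE (negPf jk).
  - by rewrite ffunE eqxx.
  rewrite (lower _ i k j)//; last 2 first.
  - by rewrite ffunE eqxx.
  - by rewrite !ffunE (negPf ki) eqxx.
  suff -> : set_digit (set_digit (set_digit e k ord0) i ord0) j ord0 = z by [].
  apply/ffunP => l; rewrite !ffunE.
  by case/or3P: (ijk l) => /eqP ->; rewrite eqxx//; do ?case: ifP.
by move=> kd kd' /(BP _ _ kd)/(to0 _ kd)/(to0 _ kd')/(BP _ _ kd'); apply.
Qed.

(** Connectedness of the vertex graph of [E_m], by induction on the generation:
inside each cube by [edge_closed_subcubes], and from cube to cube because the
vertices of a cube are among those of its subcubes. *)
Lemma edge_closed_all m (A : set point) a v a' v' : edge_closed m A ->
  menger_corners m a -> menger_corners m a' ->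
  A (vertex a (3 ^- m) v) -> A (vertex a' (3 ^- m) v').
Proof.
elim: m a v a' v' => [|m IH] a v a' v' Acl.
  by move=> -> ->; apply: Acl.
have Acl' : edge_closed m A.
  move=> b w w' bm; rewrite !(vertex_refine m b).
  by apply: edge_closed_subcubes => //; exact: kept_corner_digits.
move=> [b bm [d kd <-]] [b' bm' [d' kd' <-]].
rewrite -/(subcorner m b d) -/(subcorner m b' d') => Ab.
have k0 := kept_corner_digits (fun=> false).
apply: (edge_closed_subcubes (v := fun=> false) _ bm' Acl k0 kd').
rewrite -vertex_refine; apply: (IH b (fun=> false)) => //.
rewrite vertex_refine; exact: (edge_closed_subcubes _ bm Acl kd k0 Ab).
Qed.

Lemma menger_vertex_near m x : menger_curve R x ->
  exists2 a, menger_corners m a &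
    `|vertex a (3 ^- m) (fun=> false) - x| <= 3 ^- m.
Proof.
move=> /(_ m I)[a am xa]; exists a => //.
apply: mx_norm_leP => [|i j]; first by rewrite invr_ge0 exprn_ge0.
rewrite ord1 !mxE addr0; have /andP[lo hi] := xa j.
by rewrite ler_norml; apply/andP; split; lra.
Qed.

Lemma vertex_dist m a v w :
  `|vertex a (3 ^- m) v - vertex a (3 ^- m) w| <= 3 ^- m.
Proof.
have s0 : 0 <= (3 : R) ^- m by rewrite invr_ge0 exprn_ge0.
apply: mx_norm_leP => // i j; rewrite !mxE ler_norml.
by case: ifP => _; case: ifP => _; apply/andP; split; lra.
Qed.

Lemma exp3_small (e : R) : 0 < e -> exists m, 3 ^- m < e.
Proof.
move=> e0; have [b eb] := exp2_gt e^-1; exists b.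
rewrite invf_plt ?posrE ?exprn_gt0//; apply: (lt_le_trans eb).
by rewrite lerXn2r ?nnegrE// ler_nat.
Qed.

Lemma menger_chain_connected : chain_connected (menger_curve R : metricType R).
Proof.
move=> e A e0 [x Ax] AP y; have [m me] := exp3_small e0.
have link (u v : menger_curve R) :
    `|set_val u - set_val v| <= 3 ^- m -> A u -> A v.
  by move=> uv Au; apply: (AP _ _ Au); exact: le_lt_trans me.
pose A' : set point := set_val @` A.
have A'link (u v : point) :
    menger_curve R v -> `|u - v| <= 3 ^- m -> A' u -> A' v.
  move=> Mv uv [u' Au' uE]; rewrite -uE in uv.
  exists (SigSub (mem_set Mv)) => //; exact: link Au'.
have A'cl : edge_closed m A'.
  by move=> a v w am; apply: A'link; [exact: vertex_menger|exact: vertex_dist].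
have Mx (z : menger_curve R) : menger_curve R (set_val z) := set_mem (valP z).
have [a am ax] := menger_vertex_near m (Mx x).
have [b bm bY] := menger_vertex_near m (Mx y).
have : A' (set_val y).
  apply: (A'link _ _ (Mx y) bY); apply: (edge_closed_all _ A'cl am bm).
  apply: (A'link (set_val x)); first exact: vertex_menger.
    by rewrite distrC; exact: ax.
  by exists x.
by move=> [y' Ay' /val_inj <-].
Qed.

Lemma menger_coord x i : menger_curve R x -> 0 <= x 0 i <= 1.
Proof.
by move=> /(_ 0%N I)[_ -> /(_ i)]; rewrite !mxE add0r expr0 invr1.
Qed.

Lemma menger_diameter (x y : menger_curve R) : mdist x y <= 1.
Proof.
apply: mx_norm_leP => // i j; rewrite ord1 !mxE ler_norml.
have /andP[x0 x1] := menger_coord j (set_mem (valP x)).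
have /andP[y0 y1] := menger_coord j (set_mem (valP y)).
by apply/andP; split; lra.
Qed.

Lemma truncn_eq_dist (s t : R) : 0 <= s -> 0 <= t ->
  Num.truncn s = Num.truncn t -> `|s - t| <= 1.
Proof.
move=> s0 t0 st; have := truncn_le s; have := truncn_le t.
rewrite s0 t0 -st => ht hs; have := truncnS_gt s; have := truncnS_gt t.
by rewrite -st -natr1 ler_norml => *; apply/andP; split; lra.
Qed.

Lemma menger_colorable : finitely_colorable (menger_curve R : metricType R).
Proof.
move=> e e0; pose n := (Num.truncn e^-1).+1.
have n0 : 0 < n%:R :> R by [].
have ne : n%:R^-1 < e.
  by rewrite invf_plt ?posrE//; exact: truncnS_gt.
pose cell (x : menger_curve R) : {ffun 'I_3 -> 'I_n.+1} :=
  [ffun i => inord (Num.truncn (n%:R * (set_val x : point) 0 i))].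
exists #|{ffun 'I_3 -> 'I_n.+1}|.
exists (fun x : menger_curve R => nat_of_ord (enum_rank (cell x))).
split=> // x y.
move=> /ord_inj/enum_rank_inj xy; apply: le_lt_trans ne.
apply: mx_norm_leP => [|i j]; first by rewrite invr_ge0 ltW.
rewrite ord1 !mxE.
have /andP[x0 x1] := menger_coord j (set_mem (valP x)).
have /andP[y0 y1] := menger_coord j (set_mem (valP y)).
have cell_lt (t : R) : 0 <= t -> t <= 1 -> (Num.truncn (n%:R * t) < n.+1)%N.
  move=> t0 t1; have /le_truncn : n%:R * t <= n%:R by rewrite ler_piMr// ltW.
  by rewrite natrK ltnS.
move/ffunP: xy => /(_ j); rewrite !ffunE => /(congr1 val).
rewrite /= !inordK ?cell_lt// => /truncn_eq_dist.
rewrite !mulr_ge0 ?(ltW n0)// -mulrBr normrM gtr0_norm// => /(_ isT isT).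
by rewrite -ler_pdivlMl// mulr1.
Qed.

Lemma menger_pair : exists x y : menger_curve R, x <> y.
Proof.
have c0 : menger_corners 0 (0 : point) by [].
have M v := @vertex_menger 0 0 v c0.
exists (SigSub (mem_set (M (fun=> false)))).
exists (SigSub (mem_set (M (fun=> true)))).
move=> /(congr1 set_val)/rowP/(_ 0); rewrite !mxE expr0 invr1 => /eqP.
by rewrite !add0r eq_sym oner_eq0.
Qed.

End menger.

Theorem theorem1p1 (R : realType) :
  exists X : metricType R,
    homeomorphic X (menger_curve R) /\ qs_co_Hopfian X.
Proof.
have [x0 _] := menger_pair R.
have [p p_rec] := recurrent_sequence x0 (@menger_colorable R).
have [X [XM Xrigid]] := rigid_metric (@menger_chain_connected R)
  (menger_pair R) (@menger_colorable R) (@menger_diameter R) p_rec.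
exists X; split=> // f fqs; apply/seteqP; split=> // x _.
by exists x => //; exact: Xrigid.
Qed.
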